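(* Let $n,j\in\mathbb{Z}^+$, and let $G$ be a $j$-regular simple graph. If $n \nmid j$, then $\chi_{(n)}(G) = \chi(G)$.
   Context: A $\mathbb{Z}$-labeling of $G=(V,E)$ is a map $\ell:V\to\mathbb{Z}$; its order is the size of its range; it is proper if adjacent vertices get different labels; $\chi(G)$ is the minimum order of a proper labeling. $N(v)$ is the open neighborhood of $v$ (its neighbors, excluding $v$). An open coloring with nonzero remainders mod $n$ is a labeling with $\sum_{w\in N(v)}\ell(w)\not\equiv 0 \pmod n$ for all $v\in V$. If no proper such coloring exists, $\chi_{(n)}(G)$ does not exist; if proper such colorings of finite order exist, $\chi_{(n)}(G)$ is the minimum order of one; if they exist only of infinite order, $\chi_{(n)}(G)=\infty$. *)

(* Defs.v *)
From HB Require Import structures.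
From mathcomp Require Import all_boot all_order all_algebra finmap.
From mathcomp Require Import boolp classical_sets functions cardinality fsbigop.

Set Implicit Arguments.
Unset Strict Implicit.
Unset Printing Implicit Defensive.

Local Open Scope classical_set_scope.

(* Graphs may be infinite. Every type carries a choiceType structure under the
   classical axioms of boolp, so this is no restriction on the vertex set. *)
Record sgraph := SGraph {
  vertex :> choiceType;
  adj : rel vertex;
  adj_sym : symmetric adj;
  adj_irrefl : irreflexive adj }.

Definition nbhd (G : sgraph) (v : G) : set G := [set w | adj v w].

Definition regular (j : nat) (G : sgraph) : Prop :=
  forall v : G, (nbhd v #= `I_j)%card.

Inductive enat := Fin of nat | Infty.

Definition label_order (G : sgraph) (l : G -> int) : enat :=
  if `[< finite_set (range l) >] then Fin #|` fset_set (range l)| else Infty.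

Definition proper (G : sgraph) (l : G -> int) : Prop :=
  forall v w : G, adj v w -> l v <> l w.

(* A finitely supported sum: it is the sum over N(v) whenever N(v) is finite,
   but it would be 0 if l were nonzero infinitely often on N(v). *)
Definition open_coloring_mod (n : nat) (G : sgraph) (l : G -> int) : Prop :=
  forall v : G, (\sum_(w \in nbhd v) l w <> 0 %[mod n%:Z])%Z.

(* Infty covers both the case where the labelings satisfying P all have
   infinite order and the case where there are none. *)
Definition min_order (G : sgraph) (P : (G -> int) -> Prop) : enat :=
  if pselect (exists k, `[< exists2 l, P l & label_order l = Fin k >])
  is left h then Fin (ex_minn h) else Infty.

Definition chi (G : sgraph) : enat := min_order (@proper G).

(* None means that the invariant does not exist. *)
Definition chi_mod (n : nat) (G : sgraph) : option enat :=
  let P := fun l : G -> int => proper l /\ open_coloring_mod n l in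
  if `[< exists l, P l >] then Some (min_order P) else None.

(* Main.v *)
Require Import Defs.
From HB Require Import structures.
From mathcomp Require Import all_boot all_order all_algebra finmap.
From mathcomp Require Import boolp classical_sets functions cardinality fsbigop.

(** If [l] is proper then so is [1 + n * l], which has the same order, and each
    of its neighborhood sums is congruent to [j] modulo [n]. It remains to see
    that some proper labeling exists, as otherwise [chi_mod n G] would be [None].
    As degrees are finite, every connected component is countable, so there is a
    labeling that is injective on each component. *)

Set Implicit Arguments.
Unset Strict Implicit.
Unset Printing Implicit Defensive.

Import GRing.Theory.

Local Open Scope classical_set_scope.

Section Walks.
Variables (G : sgraph) (idx : G -> G -> nat).

(* [idx u] numbers the neighbors of [u], and [s] lists the numbers of the
   successive steps of a walk from [u] to [v]. *)
Fixpoint walk (u : G) (s : seq nat) (v : G) : Prop :=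
  if s is i :: s' then exists w, [/\ adj u w, idx u w = i & walk w s' v]
  else u = v.

Lemma walk_rcons u s v w :
  walk u s v -> adj v w -> walk u (rcons s (idx v w)) w.
Proof.
elim: s u => [|i s IHs] u /= => [<- uw|[x [ux <- xv]] vw]; first by exists w.
by exists x; split=> //; apply: IHs.
Qed.

(** Distinct neighbors of a vertex have distinct numbers, so each entry of [s] determines the next
    vertex. *)
Lemma walk_end u s v w :
    (forall x, {in nbhd x &, injective (idx x)}) ->
  walk u s v -> walk u s w -> v = w.
Proof.
move=> idx_inj; elim: s u => [|i s IHs] u /= => [<- //|].
move=> [x [ux <- xv]] [y [uy eq_yx yw]].
have eyx: y = x by apply: (idx_inj u); rewrite ?inE.
by apply: IHs xv _; rewrite -eyx.
Qed.

End Walks.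

(** A vertex is labeled by the code of a walk that reaches it from a representative of its
    component; such a code determines its endpoint. *)
Lemma countable_nbhd_proper (G : sgraph) :
  (forall v : G, countable (nbhd v)) -> exists l : G -> int, Defs.proper l.
Proof.
move=> G_count.
have /choice[idx idx_inj]: forall v : G,
    exists f : G -> nat, {in nbhd v &, injective f}.
  by move=> v; apply/countable_injP.
pose comp (v u : G) := `[< exists s, walk idx u s v >].
have comp_ex v : exists u, comp v u by exists v; apply/asboolP; exists [::].
pose rep v := xchoose (comp_ex v).
have /choice[code codeP]: forall v, exists s, walk idx (rep v) s v.
  by move=> v; apply/asboolP/(xchooseP (comp_ex v)).
exists (fun v => (choice.pickle (code v))%:Z)%R => v w vw [] /(pcan_inj choice.pickleK) eq_code.
(* [xchoose] depends only on the predicate up to pointwise equality, and walks from [u] extend along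
   the edge [vw] both ways. *)
have eq_rep: rep v = rep w.
  apply: eq_xchoose => u; apply/asboolP/asboolP => -[s us].
    by exists (rcons s (idx v w)); apply: walk_rcons us vw.
  by exists (rcons s (idx w v)); apply: walk_rcons us _; rewrite adj_sym.
have eq_vw: v = w.
  apply: walk_end idx_inj (codeP v) _.
  by rewrite eq_rep eq_code; apply: codeP.
by rewrite eq_vw adj_irrefl in vw.
Qed.

Lemma label_order_inj (G : sgraph) (f : int -> int) (l : G -> int) :
  injective f -> label_order (f \o l) = label_order l.
Proof.
move=> f_inj; rewrite /label_order.
have ->: range (f \o l) = f @` range l by rewrite image_comp.
have fin_iff: finite_set (f @` range l) <-> finite_set (range l).
  split; last exact: finite_image.
  (* [range l] lies in the preimage of its own image under [f]. *)
  move=> /(@finite_preimage _ _ _ f (in2W f_inj)).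
  exact/sub_finite_set/preimage_image.
rewrite (propext fin_iff); case: asboolP => // l_fin.
by rewrite fset_set_image // card_imfset.
Qed.

Lemma regular_open_coloring (n j : nat) (G : sgraph) (l : G -> int) :
    regular j G -> ~~ (n %| j)%N ->
  open_coloring_mod n (fun v => 1 + n%:Z * l v)%R.
Proof.
move=> G_reg n_ndvd_j v.
(* Finiteness turns the sum into a genuine one over [j] neighbors, namely [j + n * S] with [S] the
   sum of [l]. *)
have v_fin: finite_set (nbhd v) by apply/finite_setP; exists j; apply: G_reg.
rewrite fsbig_finite //= big_split /= -mulr_sumr big_const_seq.
rewrite iter_addr_0 count_predT (card_fset_set (G_reg v)) natz addrC mulrC.
rewrite modzMDl mod0z !modz_nat => -[/eqP].
exact/negP.
Qed.

Lemma eq_min_order (G : sgraph) (P Q : (G -> int) -> Prop) :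
    (forall l, P l -> exists2 l', Q l' & label_order l' = label_order l) ->
    (forall l, Q l -> exists2 l', P l' & label_order l' = label_order l) ->
  min_order P = min_order Q.
Proof.
move=> PQ QP.
(* [ex_minn h] depends on a proof about the predicate, so the predicate is abstracted as a whole and
   then replaced. *)
apply: (congr1 (fun p : pred nat =>
  if pselect (exists k, p k) is left h then Fin (ex_minn h) else Infty)).
apply/funext => k; apply: asbool_equiv_eq.
split=> -[l Hl <-]; [exact: PQ | exact: QP].
Qed.

Theorem theorem7p3 (n j : nat) (G : sgraph) (hn : (0 < n)%N) (hj : (0 < j)%N)
    (hG : regular j G) (hnj : ~~ (n %| j)%N) :
  chi_mod n G = Some (chi G).
Proof.
pose f (k : int) := (1 + n%:Z * k)%R.
have f_inj: injective f.
  by move=> a b /addrI /mulfI; apply; apply: lt0n_neq0.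
have f_good (l : G -> int) : Defs.proper l ->
    Defs.proper (f \o l) /\ open_coloring_mod n (f \o l).
  move=> l_proper; split; last exact: regular_open_coloring hG hnj.
  by move=> v w vw /f_inj; apply: l_proper.
have [l l_proper]: exists l : G -> int, Defs.proper l.
  apply: countable_nbhd_proper => v; apply: finite_set_countable.
  by apply/finite_setP; exists j; apply: hG.
rewrite /chi_mod; case: asboolP => [_|[]]; last by exists (f \o l); apply: f_good.
(* An open coloring serves as its own proper labeling; a proper [k] is replaced by [f \o k]. *)
congr Some; apply: eq_min_order => [k [k_proper _]|k k_proper]; first by exists k.
by exists (f \o k); [apply: f_good | apply: label_order_inj].
Qed.
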